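(* Let $(w,v)$ be a pair of weights on $\mathbb{R}^n$ and $1\leq p<\infty$. Then the following statements are equivalent: (a) The operator $M^{+,d}$ is of restricted weak $(p,p)$ type with respect to $(w,v)$, that is, there exists a positive constant $C$ such that the inequality $$w\left(\left\{x\in \mathbb{R}^n: M^{+,d}(\mathcal{X}_E)(x)>t\right\}\right)\leq \frac{C\,[(w,v)]_{A_p^{+,d}(\mathcal{R})}^p}{t^p}\,v(E)$$ holds for every positive $t$ and every measurable set $E$; (b) $(w,v)$ belongs to $A_p^{+,d}(\mathcal{R})$.
   Context: A weight is a nonnegative measurable function on $\mathbb{R}^n$. For a measurable set $E\subset\mathbb{R}^n$, $|E|$ is its Lebesgue measure, $w(E)=\int_E w(x)\,dx$, $v(E)=\int_E v(x)\,dx$, and $\mathcal{X}_E$ is its characteristic function. Dyadic cubes are the cubes $\prod_{i=1}^n[k_i2^j,(k_i+1)2^j)$ with $j,k_1,\dots,k_n\in\mathbb{Z}$. For a dyadic cube $Q=\prod_{i=1}^n[a_i,b_i)$, set $Q^+=\prod_{i=1}^n[b_i,2b_i-a_i)$. The dyadic one-sided Hardy-Littlewood maximal operator is $$M^{+,d}f(x)=\sup_{Q\ni x}\frac{1}{|Q|}\int_{Q^+}|f(y)|\,dy,$$ where the supremum is taken over all dyadic cubes $Q$ containing $x$. For $1\le p<\infty$, $(w,v)\in A_p^{+,d}(\mathcal{R})$ means that there exists a positive constant $C$ such that the inequality $$\frac{|E|}{|Q|}\leq C\left(\frac{v(E)}{w(Q)}\right)^{1/p}$$ holds for every dyadic cube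 $Q$ and every measurable set $E\subset Q^+$. The smallest constant $C$ for which this inequality holds is denoted by $[(w,v)]_{A_p^{+,d}(\mathcal{R})}$.
   Formalization: As [(w,v)] is undefined when (b) fails (read as infinity, (a) would not imply (b)), the equivalence is stated for (a) with an arbitrary finite constant K in place of C[(w,v)]^p; in addition (b) is stated to give (a) with C[(w,v)]^p, C depending only on n and p. If w(Q)=0 the condition is void. *)

(* Defs.v *)
From HB Require Import structures.
From mathcomp Require Import all_boot all_order all_algebra.
From mathcomp Require Import all_classical all_reals all_analysis.

Set Implicit Arguments.
Unset Strict Implicit.
Unset Printing Implicit Defensive.
Import Order.TTheory GRing.Theory Num.Theory.
Import numFieldNormedType.Exports.

Local Open Scope classical_set_scope.
Local Open Scope ring_scope.
Local Open Scope ereal_scope.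

(* The library has Lebesgue measure on R only. On R^n (tuples with the product
   Borel sigma-algebra) it is built by iterating the product measure, then
   completed, so that measurable sets below are the Lebesgue-measurable ones. *)
Section lebesgue_measure_step.
Context {R : realType} (n : nat).
Notation T := (measurableTypeR R).

Definition tcons (p : T * n.-tuple T) : n.+1.-tuple T := [tuple of p.1 :: p.2].

Lemma measurable_tcons : measurable_fun [set: T * n.-tuple T] tcons.
Proof. exact: (@measurable_cons _ _ _ T fst n snd). Qed.

Variable m : {sigma_finite_measure set (n.-tuple T) -> \bar R}.

Definition borel_lebesgueS : set (n.+1.-tuple T) -> \bar R :=
  pushforward (@lebesgue_measure R \x m) tcons.

Let step0 : borel_lebesgueS set0 = 0.
Proof. by rewrite /borel_lebesgueS /pushforward preimage_set0 measure0. Qed.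

Let step_ge0 A : 0 <= borel_lebesgueS A.
Proof. exact: (measure_ge0 (@lebesgue_measure R \x m)). Qed.

Let step_sigma_additive : semi_sigma_additive borel_lebesgueS.
Proof.
move=> F mF tF mUF; rewrite /borel_lebesgueS /pushforward preimage_bigcup.
apply: measure_semi_sigma_additive.
- by move=> k; rewrite -[X in measurable X]setTI; exact: measurable_tcons.
- apply/trivIsetP => /= i j _ _ ij; rewrite -preimage_setI.
  by move/trivIsetP : tF => /(_ _ _ _ _ ij) ->//; rewrite preimage_set0.
- by rewrite -preimage_bigcup -[X in measurable X]setTI; exact: measurable_tcons.
Qed.

HB.instance Definition _ := isMeasure.Build _ _ _ borel_lebesgueS
  step0 step_ge0 step_sigma_additive.

Let step_sigma_finite : sigma_finite setT borel_lebesgueS.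
Proof.
have /sigma_finiteP[F [FT ndF Foo]] := sigma_finiteT (@lebesgue_measure R).
have /sigma_finiteP[G [GT ndG Goo]] := sigma_finiteT m.
pose u (x : n.+1.-tuple T) : T * n.-tuple T := (thead x, [tuple of behead x]).
have mu_ : measurable_fun [set: n.+1.-tuple T] u.
  apply/measurable_fun_pairP; split.
    exact: measurable_tnth.
  exact: measurable_behead.
have FGT : \bigcup_k (F k `*` G k) = setT.
  rewrite -setXTT FT GT; apply/seteqP; split => -[x y] /=.
    by move=> [k _ [/= ? ?]]; split; exists k.
  move=> [[j _ Fjx] [k _ Gky]]; exists (maxn j k) => //; split.
    by move: x Fjx; exact/subsetPset/ndF/leq_maxl.
  by move: y Gky; exact/subsetPset/ndG/leq_maxr.
exists (fun k => u @^-1` (F k `*` G k)).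
  by rewrite -preimage_bigcup FGT preimage_setT.
move=> k; have [mF Fk] := Foo k; have [mG Gk] := Goo k; split.
  by rewrite -[X in measurable X]setTI; apply: mu_ => //; exact: measurableX.
rewrite /borel_lebesgueS /pushforward -comp_preimage.
rewrite (_ : u \o tcons = id); last first.
  apply/funext => -[x t]; by congr pair; apply/val_inj.
by rewrite preimage_id product_measure1E// lte_mul_pinfty// ge0_fin_numE.
Qed.

HB.instance Definition _ := @Measure_isSigmaFinite.Build _ _ _
  borel_lebesgueS step_sigma_finite.

End lebesgue_measure_step.

Fixpoint borel_lebesgue {R : realType} (n : nat) :
    {sigma_finite_measure set (n.-tuple (measurableTypeR R)) -> \bar R} :=
  match n with
  | 0%N => \d_ [tuple]
  | k.+1 => borel_lebesgueS (borel_lebesgue k)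
  end.

Section tuple_box.
Context {R : realType}.
Notation T := (measurableTypeR R).

Lemma measurable_tuple_box n (a b : 'I_n -> R) :
  measurable [set x : n.-tuple T | forall i, (a i <= tnth x i < b i)%R].
Proof.
rewrite (_ : [set x | _] =
    \bigcap_(i in [set: 'I_n]) ((@tnth n T ^~ i) @^-1` `[a i, b i[%classic)).
  apply: fin_bigcap_measurable; first exact: finite_finset.
  move=> i _; rewrite -[X in measurable X]setTI; exact: measurable_tnth.
apply/seteqP; split => x /= H i; first by move=> _ /=; rewrite in_itv /= H.
by have := H i I; rewrite /= in_itv.
Qed.

Lemma borel_lebesgue_box n (a b : 'I_n -> R) : (forall i, (a i <= b i)%R) ->
  borel_lebesgue n [set x | forall i, (a i <= tnth x i < b i)%R] =
  (\prod_(i < n) (b i - a i))%R%:E.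
Proof.
elim: n a b => [|n IH] a b ab.
  by rewrite big_ord0 /= diracE mem_set//= => -[].
rewrite big_ord_recl EFinM -(IH (a \o lift ord0) (b \o lift ord0)); last by move=> i /=.
rewrite /= /borel_lebesgueS /pushforward.
rewrite (_ : _ @^-1` _ = `[a ord0, b ord0[%classic `*`
   [set x : n.-tuple T | forall i, (a (lift ord0 i) <= tnth x i < b (lift ord0 i))%R]); last first.
  apply/seteqP; split => -[x y] /=.
    move=> H; split; first by have := H ord0; rewrite /= in_itv.
    by move=> i; have := H (lift ord0 i); rewrite tnthS.
  move=> [+ H] i; rewrite in_itv /= => H0.
  by case: (unliftP ord0 i) => [j ->|->//]; rewrite tnthS.
rewrite product_measure1E//; last exact: measurable_tuple_box.
congr (_ * _).
apply: (etrans (@lebesgue_measure_itv R `[a ord0, b ord0[)).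
rewrite /= lte_fin.
case: ltP => //= H.
by have /eqP -> : b ord0 == a ord0; rewrite ?subrr// eq_le H ab.
Qed.

End tuple_box.

Definition Rn (R : realType) (n : nat) : Type :=
  caratheodory_type ((@borel_lebesgue R n)^*)%mu.

HB.instance Definition _ (R : realType) (n : nat) := Measurable.on (Rn R n).

Definition lebesgue {R : realType} {n : nat} : set (Rn R n) -> \bar R :=
  @completed_measure_extension _ _ _ (@borel_lebesgue R n).

HB.instance Definition _ (R : realType) (n : nat) :=
  Measure.on (@lebesgue R n).

Section box.
Context {R : realType} {n : nat}.

Definition coord (x : Rn R n) (i : 'I_n) : R := tnth x i.

Definition box (a b : 'I_n -> R) : set (Rn R n) :=
  [set x | forall i, (a i <= coord x i < b i)%R].

Lemma measurable_box (a b : 'I_n -> R) : measurable (box a b).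
Proof.
apply: (@caratheodory_measurable_mu_ext _ R _ (@borel_lebesgue R n)).
exact: measurable_tuple_box.
Qed.

Lemma lebesgue_box (a b : 'I_n -> R) : (forall i, (a i <= b i)%R) ->
  lebesgue (box a b) = (\prod_(i < n) (b i - a i))%R%:E.
Proof.
move=> ab; rewrite -borel_lebesgue_box//.
rewrite /lebesgue /completed_measure_extension measurable_mu_extE//.
exact: measurable_tuple_box.
Qed.

End box.

Section definitions.
Context {R : realType} {n : nat}.
Implicit Types (w v f : Rn R n -> R) (E : set (Rn R n)).

Definition dyadic_lo (j : int) (k : 'I_n -> int) (i : 'I_n) : R :=
  ((k i)%:~R * 2 ^ j)%R.

Definition dyadic_hi (j : int) (k : 'I_n -> int) (i : 'I_n) : R :=
  ((k i + 1)%:~R * 2 ^ j)%R.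

Definition dyadic_cube j k : set (Rn R n) :=
  box (dyadic_lo j k) (dyadic_hi j k).

Definition dyadic_cube_plus j k : set (Rn R n) :=
  box (dyadic_hi j k) (fun i => 2 * dyadic_hi j k i - dyadic_lo j k i)%R.

Definition dyadic_maximal f (x : Rn R n) : \bar R :=
  ereal_sup [set (lebesgue (dyadic_cube jk.1 jk.2))^-1 *
                 \int[lebesgue]_(y in dyadic_cube_plus jk.1 jk.2) `|f y|%:E
            | jk in [set jk : int * ('I_n -> int) | dyadic_cube jk.1 jk.2 x]].

Definition weight w : Prop :=
  (forall x, (0 <= w x)%R) /\ measurable_fun [set: Rn R n] w.

Definition wmeas w E : \bar R := \int[lebesgue]_(x in E) (w x)%:E.

(* The library's [a / b] is 0 when a = b = 0; here a / 0 = +oo for every a, so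
   that the A_p inequality imposes nothing on cubes Q with w(Q) = 0. *)
Definition quotient (a b : \bar R) : \bar R := if b == 0 then +oo else a / b.

Definition Ap_bound (p : R) w v (C : R) : Prop :=
  forall j k E, measurable E -> E `<=` dyadic_cube_plus j k ->
    lebesgue E / lebesgue (dyadic_cube j k) <=
      C%:E * (quotient (wmeas v E) (wmeas w (dyadic_cube j k))) `^ (p^-1)%R.

Definition Ap (p : R) w v : Prop := exists2 C : R, (0 < C)%R & Ap_bound p w v C.

(* An infimum rather than a minimum: when w = 0 a.e. every positive C is
   admissible and the constant is 0. It is +oo when (w, v) is not in the class. *)
Definition Ap_const (p : R) w v : \bar R :=
  ereal_inf [set C%:E | C in [set C : R | (0 < C)%R /\ Ap_bound p w v C]].

Definition restricted_weak_type (p : R) w v (K : \bar R) : Prop :=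
  forall (t : R) E, (0 < t)%R -> measurable E ->
    wmeas w [set x | t%:E < dyadic_maximal \1_E x] <=
      K / (t `^ p)%:E * wmeas v E.

End definitions.

(* Main.v *)
From HB Require Import structures.
Require Import Defs.
From mathcomp Require Import all_boot all_order all_algebra.
From mathcomp Require Import all_classical all_reals all_analysis.
From mathcomp Require Import measurable_realfun ring lra.

(** Write [Q+] for the cube attached to [Q]. The level set of the maximal
    function of the indicator of [E] at height [t] is the union of the dyadic
    cubes [Q] with [t * |Q| < |E `&` Q+|] ([dyadic_maximal_gt]).

    That restricted weak type implies the A_p condition is a matter of testing
    on [E `<=` Q+]: then [Q] lies in every level set of height
    [t < |E| / |Q|], so [t ^ p * w(Q) <= K * v(E)], and [t] can be pushed to
    [|E| / |Q|] ([restricted_weak_type_Ap]).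

    For the converse, the A_p condition reads
    [s ^ p * w(Q) <= c ^ p * v(A)] whenever [A `<=` Q+] and [|A| >= s * |Q|]
    ([one_sided_testing]). It is natural to select disjoint cubes [Q] covering
    the level set and to apply this to [A = E `&` Q+]; the obstacle is that the
    sets [Q+] overlap although the cubes [Q] do not, so the sum of the
    [v(E `&` Q+)] is out of control. Two ideas repair this.

    First, split the cubes according to the dyadic size of the density
    [|E `&` Q+| / |Q|]. The bound at height [2 ^ k * t] carries the factor
    [2 ^ (- k * p)] with [p >= 1], so the levels add up geometrically and it
    suffices to treat cubes whose density lies between [t] and [2 * t]
    ([finite_cover_bound]).

    Second, at one density level the sets [Q+] form a Carleson family with
    respect to the restriction of Lebesgue measure to [E]. Indeed, if [P] is
    not larger than [Q] and [P+] meets [Q+], then [P] sits in a cubical box of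
    side three times that of [Q] ([dyadic_cube_sub_nearby_box]); the selected
    [P] being disjoint, their volumes sum to at most [3 ^ n * |Q|], and since
    [|E `&` P+| <= 2 * t * |P|] the sum of the [|E `&` P+|] is at most
    [2 * 3 ^ n * t * |Q|]. By Markov's inequality the points of [E `&` Q+] that
    lie in at least [4 * 3 ^ n] of these [P+] have measure at most
    [t * |Q| / 2]. Discarding them from [Q+] leaves a part that still contains
    [t * |Q| / 2] of the mass of [E] ([sparse_part_large]), and these parts
    overlap at most [4 * 3 ^ n] times ([sparse_part_overlap]): among the
    parts containing [x], the one of the largest cube counts all the others.
    Testing on the sparse parts and summing gives [one_density_level_bound].

    The cubes are handled in finite lists; monotone convergence passes to the
    countable family ([testing_restricted_weak_type]). The optimal constant is
    an infimum, and it is itself admissible in the testing condition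
    ([Ap_const_testing]). *)

Set Implicit Arguments.
Unset Strict Implicit.
Unset Printing Implicit Defensive.
Import Order.TTheory GRing.Theory Num.Theory.

Local Open Scope classical_set_scope.
Local Open Scope ring_scope.
Local Open Scope ereal_scope.

(** * Masses of overlapping families of sets *)

Section integral_over_sets.
Context {d : measure_display} {T : measurableType d} {R : realType}
  (mu : {measure set T -> \bar R}).
Variable f : T -> R.
Hypotheses (f0 : forall x, (0 <= f x)%R) (mf : measurable_fun [set: T] f).
Implicit Types (A D E : set T) (I : Type).

Let mass D := \int[mu]_(x in D) (f x)%:E.

Let mfD D : measurable_fun D (EFin \o f).
Proof. by apply/measurable_EFinP; exact: measurable_funTS. Qed.

Let fE0 x : 0 <= (f x)%:E.
Proof. by rewrite lee_fin. Qed.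

Lemma le_int_subset D E : measurable D -> measurable E -> D `<=` E ->
  mass D <= mass E.
Proof. by move=> mD mE DE; apply: ge0_subset_integral. Qed.

Lemma int_setU_le D E : measurable D -> measurable E ->
  mass (D `|` E) <= mass D + mass E.
Proof.
move=> mD mE; have mED : measurable (E `\` D) by exact: measurableD.
have -> : D `|` E = D `|` (E `\` D).
  apply/seteqP; split => x; last by case=> [|[]]; [left|right].
  by move=> [|Ex]; [left|have [|] := pselect (D x); [left|right]].
rewrite /mass ge0_integral_setU//.
- by rewrite leeD2l//; apply: le_int_subset => // x [].
- by rewrite disj_set2E; apply/eqP/seteqP; split => // x [Dx []].
Qed.

Lemma int_bigsetU_le I (s : seq I) (A : I -> set T) :
  (forall i, measurable (A i)) ->
  mass (\big[setU/set0]_(i <- s) A i) <= \sum_(i <- s) mass (A i).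
Proof.
move=> mA; elim: s => [|i s IH].
  by rewrite !big_nil /mass integral_set0.
rewrite !big_cons; apply: (le_trans (int_setU_le _ _)) => //.
  exact: bigsetU_measurable.
by rewrite leeD2l.
Qed.

Lemma int_bigcup_le (F : nat -> set T) (M : \bar R) :
  {homo F : m m' / (m <= m')%N >-> (m <= m')%O} ->
  (forall m, measurable (F m)) -> (forall m, mass (F m) <= M) ->
  mass (\bigcup_m F m) <= M.
Proof.
move=> ndF mF FM.
have cvF := @ge0_nondecreasing_set_cvg_integral _ _ _ F (EFin \o f) mu
  ndF mF (fun m => @mfD (F m)) (fun _ _ _ => fE0 _).
rewrite -[mass _](cvg_lim _ cvF)//; apply: lime_le; last by near=> m; exact: FM.
by apply/cvg_ex; eexists; exact: cvF.
Unshelve. all: by end_near. Qed.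

Lemma measurable_count I (s : seq I) (A : I -> set T) :
  (forall i, measurable (A i)) ->
  measurable_fun [set: T] (fun x => (count (fun i => x \in A i) s)%:R : R).
Proof.
move=> mA.
rewrite (_ : (fun x => _) = fun x => (\sum_(i <- s) \1_(A i) x)%R).
  by apply: measurable_sum => i; exact: measurable_indic.
apply/funext => x; rewrite -sum1_count natr_sum big_mkcond.
by apply: eq_bigr => i _; rewrite indicE; case: (x \in A i).
Qed.

Lemma measurable_count_lt I (s : seq I) (A : I -> set T) M :
  (forall i, measurable (A i)) ->
  measurable [set x | (count (fun i => x \in A i) s < M)%N].
Proof.
move=> mA; have mc := @measurable_count _ s _ mA.
rewrite (_ : [set x | _] = setT `&`
    ((fun x => (count (fun i => x \in A i) s)%:R : R) @^-1` `]-oo, M%:R[)).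
  by apply: mc => //; exact: measurable_itv.
by apply/seteqP; split => x /=; rewrite in_itv/= ltr_nat; [|case].
Qed.

(** Exchanging sum and integral turns the total mass of the pieces into an
    integral against the counting function of the family. Bounds on the overlap
    thus become bounds on sums of masses, in both directions. *)
Lemma sum_int_setI I (s : seq I) (A : I -> set T) D :
  measurable D -> (forall i, measurable (A i)) ->
  \sum_(i <- s) mass (D `&` A i) =
  \int[mu]_(x in D) ((f x)%:E * (count (fun i => x \in A i) s)%:R%:E).
Proof.
move=> mD mA.
transitivity (\sum_(i <- s) \int[mu]_(x in D) ((f x)%:E * (\1_(A i) x)%:E)).
  by apply: eq_bigr => i _; rewrite /mass integral_mkcondr epatch_indic.
rewrite -ge0_integral_sum//.
- apply: eq_integral => x _; rewrite -ge0_sume_distrr; last first.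
    by move=> i _; rewrite lee_fin.
  rewrite sumEFin -sum1_count natr_sum [in RHS]big_mkcond; congr (_ * _%:E).
  by apply: eq_bigr => i _; rewrite indicE; case: (x \in A i).
- move=> i; apply: emeasurable_funM; first exact: mfD.
  by apply/measurable_EFinP; exact: measurable_indic.
- by move=> i x _; rewrite mule_ge0// lee_fin.
Qed.

Let measurable_mul_count I (s : seq I) (A : I -> set T) D :
  (forall i, measurable (A i)) ->
  measurable_fun D (fun x => (f x)%:E * (count (fun i => x \in A i) s)%:R%:E).
Proof.
move=> mA; apply: emeasurable_funM; first exact: mfD.
by apply/measurable_EFinP/measurable_funTS; exact: measurable_count.
Qed.

Lemma sum_int_setI_le I (s : seq I) (A : I -> set T) D M :
  measurable D -> (forall i, measurable (A i)) ->
  (forall x, D x -> (count (fun i => x \in A i) s <= M)%N) ->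
  \sum_(i <- s) mass (D `&` A i) <= M%:R%:E * mass D.
Proof.
move=> mD mA H; rewrite sum_int_setI// -ge0_integralZl_EFin//.
apply: ge0_le_integral => //.
- by move=> x _; rewrite mule_ge0// lee_fin.
- exact: measurable_mul_count.
- by apply: measurable_funeM; exact: mfD.
- by move=> x Dx; rewrite muleC lee_wpmul2r// lee_fin ler_nat H.
Qed.

Lemma sum_int_setI_ge I (s : seq I) (A : I -> set T) D M :
  measurable D -> (forall i, measurable (A i)) ->
  (forall x, D x -> (M <= count (fun i => x \in A i) s)%N) ->
  M%:R%:E * mass D <= \sum_(i <- s) mass (D `&` A i).
Proof.
move=> mD mA H; rewrite sum_int_setI// -ge0_integralZl_EFin//.
apply: ge0_le_integral => //.
- by move=> x _; rewrite mule_ge0// lee_fin.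
- by apply: measurable_funeM; exact: mfD.
- exact: measurable_mul_count.
- by move=> x Dx; rewrite muleC lee_wpmul2l// lee_fin ler_nat H.
Qed.

End integral_over_sets.

Section measure_overlap.
Context {d : measure_display} {T : measurableType d} {R : realType}
  (mu : {measure set T -> \bar R}).
Context {I : Type} (s : seq I) (A : I -> set T) (D : set T).
Hypotheses (mD : measurable D) (mA : forall i, measurable (A i)).

Let measure_int E : measurable E -> \int[mu]_(x in E) (cst 1%R x)%:E = mu E.
Proof. by move=> mE; apply: etrans (integral_cst _ mE 1%E) (mul1e _). Qed.

(** Markov's inequality for the counting function. *)
Lemma sum_measure_setI_ge M :
  (forall x, D x -> (M <= count (fun i => x \in A i) s)%N) ->
  M%:R%:E * mu D <= \sum_(i <- s) mu (D `&` A i).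
Proof.
move=> H; rewrite -measure_int//.
under eq_bigr do rewrite -(measure_int (measurableI _ _ mD (mA _))).
by apply: sum_int_setI_ge.
Qed.

Lemma sum_measure_disjoint_le :
  pairwise (fun i j => `[< A i `&` A j = set0 >]) s ->
  \sum_(i <- s) mu (D `&` A i) <= mu D.
Proof.
move=> ps; rewrite -[leRHS]mul1e -measure_int//.
under eq_bigr do rewrite -(measure_int (measurableI _ _ mD (mA _))).
apply: (@sum_int_setI_le _ _ _ _ _ _ _ _ _ _ _ 1%N) => // x _.
(* Disjointness bounds the overlap by one. *)
pose p i := x \in A i; rewrite -[count _ _]/(count p s) -size_filter.
have := filter_all p s; have := pairwise_filter p ps.
case: [seq i <- s | p i] => [//|i [//|j t]] /= /andP[/andP[/asboolP ij _] _].
move=> /and3P[/set_mem xi /set_mem xj _].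
by suff : set0 x by []; rewrite -ij.
Qed.

End measure_overlap.

(** * Selection in laminar families and geometry of dyadic cubes *)

Section laminar_families.
Context {I : eqType} {T : Type} (A : I -> set T).

(** Keeping only maximal members. Each new set is either swallowed by a selected
    one, or swallows every selected set that it meets. *)
Lemma laminar_disjoint_cover (s : seq I) :
  (forall i j, [\/ A i `<=` A j, A j `<=` A i | A i `&` A j = set0]) ->
  exists g : seq I, [/\ {subset g <= s},
    pairwise (fun i j => `[< A i `&` A j = set0 >]) g &
    {in s, forall i, exists2 j, j \in g & A i `<=` A j}].
Proof.
move=> lam; elim: s => [|i s [g [gs dg cg]]]; first by exists [::].
have [[j jg Aij]|Ng] := pselect (exists2 j, j \in g & A i `<=` A j).
  exists g; split => // [l /gs|l]; first by rewrite inE orbC => ->.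
  by rewrite inE => /predU1P[->|/cg//]; exists j.
exists (i :: [seq j <- g | `[< A i `&` A j = set0 >]]); split.
- move=> j; rewrite !inE mem_filter => /predU1P[->|]; first by rewrite eqxx.
  by move=> /andP[_ /gs ->]; rewrite orbT.
- by rewrite /= filter_all; exact: pairwise_filter.
- move=> l; rewrite inE => /predU1P[->|/cg[j jg Alj]].
    by exists i => //; rewrite inE eqxx.
  case: (lam i j) => [Aij|Aji|A0].
  + by case: Ng; exists j.
  + by exists i; [rewrite inE eqxx|exact: subset_trans Aji].
  + exists j => //; rewrite inE mem_filter jg andbT orbC.
    by apply/orP; left; apply/asboolP.
Qed.
End laminar_families.

Section dyadic_geometry.
Context {R : realType} {n : nat}.
Implicit Types (j : int) (k : 'I_n -> int).

Lemma dyadic_hiE j k i : dyadic_hi j k i = (dyadic_lo j k i + 2 ^ j)%R :> R.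
Proof. by rewrite /dyadic_hi /dyadic_lo intrD mulrDl mul1r. Qed.

Lemma side_gt0 j : (0 < 2 ^ j :> R)%R.
Proof. exact: exprz_gt0. Qed.

Lemma measurable_dyadic_cube j k : measurable (@dyadic_cube R n j k).
Proof. exact: measurable_box. Qed.

Lemma measurable_dyadic_cube_plus j k : measurable (@dyadic_cube_plus R n j k).
Proof. exact: measurable_box. Qed.

Lemma lebesgue_cubical_box (a b : 'I_n -> R) (l : R) : (0 <= l)%R ->
  (forall i, b i = a i + l)%R -> lebesgue (box a b) = (l ^+ n)%:E.
Proof.
move=> l0 bE; rewrite lebesgue_box; last by move=> i; rewrite bE lerDl.
congr EFin; under eq_bigr do rewrite bE addrC addKr.
by rewrite prodr_const card_ord.
Qed.

Lemma lebesgue_dyadic_cube j k :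
  lebesgue (@dyadic_cube R n j k) = ((2 ^ j) ^+ n)%:E.
Proof.
apply: lebesgue_cubical_box; first exact/ltW/side_gt0.
exact: dyadic_hiE.
Qed.

Lemma lebesgue_dyadic_cube_plus j k :
  lebesgue (@dyadic_cube_plus R n j k) = ((2 ^ j) ^+ n)%:E.
Proof.
apply: lebesgue_cubical_box; first exact/ltW/side_gt0.
by move=> i; rewrite dyadic_hiE; ring.
Qed.

Lemma dyadic_cube_nested j k j' k' (x : Rn R n) : (j <= j')%R ->
  dyadic_cube j k x -> dyadic_cube j' k' x ->
  dyadic_cube j k `<=` @dyadic_cube R n j' k'.
Proof.
move=> jj' Qx Q'x z Qz i.
have [/= Q1 Q2] := andP (Qx i); have [/= Q3 Q4] := andP (Q'x i).
have [/= z1 z2] := andP (Qz i).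
(* With m = j' - j, the larger cubes have endpoints on the lattice of mesh
   2 ^ j, so that strict inequalities between lattice points can be rounded. *)
have /gez0_abs : (0 <= j' - j)%R by rewrite subr_ge0.
set m := absz _ => jm.
have side : (2 ^ j' = (2 ^+ m)%:~R * 2 ^ j :> R)%R.
  by rewrite -[j'](subrK j) -jm expfzDr// -exprnP rmorphXn.
have lo : (k' i * 2 ^+ m <= k i)%R.
  rewrite -ltzD1 -(ltr_int R) -(ltr_pM2r (side_gt0 j)) intrM -mulrA -side.
  exact: le_lt_trans Q3 Q2.
have hi : (k i + 1 <= (k' i + 1) * 2 ^+ m)%R.
  rewrite lezD1 -(ltr_int R) -(ltr_pM2r (side_gt0 j)) intrM -mulrA -side.
  exact: le_lt_trans Q1 Q4.
apply/andP; split.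
  apply: le_trans z1; rewrite /dyadic_lo side mulrA -intrM.
  by rewrite ler_pM2r ?side_gt0// ler_int.
apply: (lt_le_trans z2); rewrite /dyadic_hi side mulrA -intrM.
by rewrite ler_pM2r ?side_gt0// ler_int.
Qed.

(** The cube that reaches from the lower corner of [Q] minus one side to the
    upper corner of [Q+]: its side is three times that of [Q]. *)
Definition nearby_box j k : set (Rn R n) :=
  box (fun i => dyadic_hi j k i - 2 * 2 ^ j)%R
      (fun i => dyadic_hi j k i + 2 ^ j)%R.

Lemma lebesgue_nearby_box j k :
  lebesgue (nearby_box j k) = (3 ^+ n * (2 ^ j) ^+ n)%:E.
Proof.
rewrite -exprMn; apply: lebesgue_cubical_box.
  by rewrite mulr_ge0// ltW// side_gt0.
by move=> i; ring.
Qed.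

(** A small cube is at distance at most its own side from any point of its
    attached cube, hence close to every larger cube whose attached cube
    meets it. *)
Lemma dyadic_cube_sub_nearby_box j k j' k' (x : Rn R n) : (j <= j')%R ->
  dyadic_cube_plus j k x -> dyadic_cube_plus j' k' x ->
  dyadic_cube j k `<=` nearby_box j' k'.
Proof.
move=> jj' Px P'x z Qz i.
have [/= P1 P2] := andP (Px i); have [/= P3 P4] := andP (P'x i).
have [/= z1 z2] := andP (Qz i).
have l0 := side_gt0 j.
have ll' : (2 ^ j <= 2 ^ j' :> R)%R by rewrite ler_weXz2l// ler1n.
move: P1 P2 P3 P4 z1 z2; rewrite !dyadic_hiE.
move: (dyadic_lo j k i) (dyadic_lo j' k' i) (2 ^ j)%R (2 ^ j')%R l0 ll'.
move: (Defs.coord x i) (Defs.coord z i) => u v a b l l' *.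
by apply/andP; split; lra.
Qed.

End dyadic_geometry.

(** * Sparse parts of the attached cubes *)

Lemma exists_max_seq (I : eqType) (f : I -> int) (s : seq I) : s != [::] ->
  exists2 i, i \in s & {in s, forall j, (f j <= f i)%R}.
Proof.
elim: s => // i [_ _|j s IH _].
  by exists i => [|j]; rewrite inE// => /eqP ->.
have [//|l ls lmax] := IH.
have [il|li] := lerP (f i) (f l).
  by exists l => [|a]; rewrite inE ?ls ?orbT// => /predU1P[->//|]; exact: lmax.
exists i => [|a]; rewrite inE ?eqxx// => /predU1P[->//|/lmax h].
exact/ltW/(le_lt_trans h).
Qed.

(** Finite functions make the indices a countable type, which plain functions
    are not. *)
Definition cube_index (n : nat) : Type := (int * {ffun 'I_n -> int})%type.
HB.instance Definition _ n := Countable.on (cube_index n).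

(** The factor [3 ^ n] is the volume ratio between [nearby_box] and the cube.
    One factor 2 is the ratio between the extreme densities of a level, the
    other makes the discarded part at most half of the mass of [E] in [Q+]. *)
Definition overlap_bound (n : nat) : nat := (4 * 3 ^ n)%N.

Section one_sided_bound.
Context {R : realType} {n : nat}.
Implicit Types (w v : Rn R n -> R) (E : set (Rn R n)).

Implicit Types (d : cube_index n).

Definition cube d : set (Rn R n) := dyadic_cube d.1 d.2.
Definition cube_plus d : set (Rn R n) := dyadic_cube_plus d.1 d.2.
Definition volume d : R := ((2 ^ d.1) ^+ n)%R.

Lemma volume_gt0 d : (0 < volume d)%R.
Proof. by rewrite exprn_gt0// side_gt0. Qed.

Lemma measurable_cube d : measurable (cube d).
Proof. exact: measurable_dyadic_cube. Qed.

Lemma measurable_cube_plus d : measurable (cube_plus d).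
Proof. exact: measurable_dyadic_cube_plus. Qed.

Lemma lebesgue_cube d : lebesgue (cube d) = (volume d)%:E.
Proof. exact: lebesgue_dyadic_cube. Qed.

Lemma lebesgue_cube_plus d : lebesgue (cube_plus d) = (volume d)%:E.
Proof. exact: lebesgue_dyadic_cube_plus. Qed.

Lemma cube_laminar d d' :
  [\/ cube d `<=` cube d', cube d' `<=` cube d | cube d `&` cube d' = set0].
Proof.
have [[x [dx d'x]]|N] := pselect (cube d `&` cube d' !=set0); last first.
  by apply: Or33; apply/seteqP; split => // x xx; case: N; exists x.
have [jj'|/ltW j'j] := lerP d.1 d'.1.
  by apply: Or31; exact: dyadic_cube_nested dx d'x.
by apply: Or32; exact: dyadic_cube_nested d'x dx.
Qed.

(** The A_p inequality freed of quotients and roots. It stays meaningful for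
    [c = 0], which the optimal constant can be. *)
Definition one_sided_testing (p : R) w v (c : R) : Prop :=
  forall d A (s : R), measurable A -> A `<=` cube_plus d -> (0 < s)%R ->
    (s * volume d)%:E <= lebesgue A ->
    (s `^ p)%:E * wmeas w (cube d) <= (c `^ p)%:E * wmeas v A.

Section sparse_parts.
Variables (g : seq (cube_index n)) (E : set (Rn R n)) (t : R).
Hypotheses (mE : measurable E) (t0 : (0 < t)%R).
Hypothesis disj : pairwise (fun i j => `[< cube i `&` cube j = set0 >]) g.
Hypothesis lo :
  {in g, forall d, (t * volume d)%:E < lebesgue (E `&` cube_plus d)}.
Hypothesis hi :
  {in g, forall d, lebesgue (E `&` cube_plus d) <= (2 * t * volume d)%:E}.

Let smaller_plus d d' : set (Rn R n) :=
  if (d'.1 <= d.1)%R then cube_plus d' else set0.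

(** The points of the attached cube that belong to few attached cubes of members
    of [g] that are not larger. *)
Definition sparse_part d : set (Rn R n) :=
  cube_plus d `&`
  [set x | (count (fun d' => x \in smaller_plus d d') g < overlap_bound n)%N].

Let measurable_smaller_plus d d' : measurable (smaller_plus d d').
Proof.
rewrite /smaller_plus; case: ifP => _; first exact: measurable_cube_plus.
exact: measurable0.
Qed.

Lemma measurable_sparse_part d : measurable (sparse_part d).
Proof.
apply: measurableI; first exact: measurable_cube_plus.
by apply: (measurable_count_lt (R := R)) => d'; exact: measurable_smaller_plus.
Qed.

(** All cubes whose sparse part contains [x] are counted in the sparse part of
    the largest of them. *)
Lemma sparse_part_overlap x :
  (count (fun d => x \in sparse_part d) g <= overlap_bound n)%N.
Proof.
rewrite -size_filter; set gx := [seq d <- g | _].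
have [->//|gx0] := eqVneq gx [::].
have [d dgx dmax] := exists_max_seq (fun d => d.1) gx0.
have /set_mem[_ /= /ltnW dM] : x \in sparse_part d.
  by move: dgx; rewrite mem_filter => /andP[].
apply: leq_trans dM.
have : all (fun d' => x \in smaller_plus d d') gx.
  apply/allP => d' d'gx; rewrite /smaller_plus dmax//.
  by move: d'gx; rewrite mem_filter => /andP[/set_mem[? _] _]; exact/mem_set.
rewrite all_count => /eqP <-; rewrite count_filter; apply: sub_count => d' /=.
by case/andP.
Qed.

(** Markov's inequality on the removed set [B], whose points lie in at least
    [overlap_bound n] attached cubes. The cubes involved are disjoint and all
    contained in [nearby_box], which bounds the sum of the intersections. *)
Lemma sparse_part_large d : d \in g ->
  (t / 2 * volume d)%:E <= lebesgue (E `&` sparse_part d).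
Proof.
move=> dg.
set EQ := E `&` cube_plus d.
have mEQ : measurable EQ.
  by apply: measurableI => //; exact: measurable_cube_plus.
set B := EQ `\` sparse_part d.
have mB : measurable B.
  by apply: measurableD => //; exact: measurable_sparse_part.
have BE : lebesgue EQ = lebesgue (E `&` sparse_part d) + lebesgue B.
  rewrite -measureU//.
  - congr lebesgue; apply/seteqP; split => x.
      move=> xE; have [|] := pselect (sparse_part d x); last by right.
      by left; split => //; case: xE.
    by move=> [[? []]|[]].
  - by apply: measurableI => //; exact: measurable_sparse_part.
  - by apply/seteqP; split => // x [[_ ?] []].
(* The Carleson estimate: cubes whose attached cube misses that of d contribute
   nothing, the others are packed in the nearby box. *)
have MB : (overlap_bound n)%:R%:E * lebesgue B <=
    (2 * t)%:E * lebesgue (nearby_box d.1 d.2).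
  apply: (@le_trans _ _ (\sum_(d' <- g) lebesgue (B `&` smaller_plus d d'))).
    apply: sum_measure_setI_ge => // x [[Ex dx] Nx].
    rewrite leqNgt; apply/negP => lt.
    by apply: Nx; split.
  apply: (@le_trans _ _ (\sum_(d' <- g)
      (2 * t)%:E * lebesgue (nearby_box d.1 d.2 `&` cube d'))).
    rewrite big_seq [leRHS]big_seq; apply: lee_sum => d' d'g.
    have [[x [[[Ex dx] _] d'x]]|B0] :=
      pselect (B `&` smaller_plus d d' !=set0); last first.
      rewrite [X in lebesgue X](_ : _ = set0); last first.
        by apply/seteqP; split => // x xB; case: B0; exists x.
      rewrite measure0 mule_ge0// lee_fin mulr_ge0// ltW//.
    move: d'x; rewrite /smaller_plus; case: ifPn => // d'd d'x.
    rewrite (setIidr (dyadic_cube_sub_nearby_box d'd d'x dx)).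
    rewrite [lebesgue (dyadic_cube _ _)]lebesgue_cube -EFinM.
    apply: le_trans (hi d'g); apply: le_measure.
    - by rewrite inE; apply: measurableI => //; exact: measurable_cube_plus.
    - by rewrite inE; apply: measurableI => //; exact: measurable_cube_plus.
    - by move=> y [[[? ?] ?] ?].
  rewrite -ge0_sume_distrr; last by move=> *; exact: measure_ge0.
  apply: lee_wpmul2l; first by rewrite lee_fin mulr_ge0// ltW.
  apply: sum_measure_disjoint_le => //; first exact: measurable_box.
  exact: measurable_cube.
have EQfin : lebesgue EQ \is a fin_num.
  rewrite ge0_fin_numE//; apply: le_lt_trans (hi dg) _; exact: ltry.
move: EQfin (lo dg); rewrite -/EQ BE fin_numD => /andP[].
move: (lebesgue (E `&` _)) (lebesgue B) MB => [e| |] [b| |]//.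
rewrite lebesgue_nearby_box -!EFinM -EFinD lee_fin lte_fin /volume.
move=> MB _ _ lod.
rewrite lee_fin; set V := ((2 ^ d.1) ^+ n)%R in MB lod *.
have T0 : (0 < 3 ^+ n :> R)%R by rewrite exprn_gt0.
have : (b <= t / 2 * V)%R.
  rewrite -(ler_pM2l T0) -(ler_pM2l (ltr0Sn R 3)).
  move: MB; rewrite /overlap_bound natrM natrX; lra.
by lra.
Qed.

End sparse_parts.
End one_sided_bound.

(** * The estimate for finitely many cubes *)

Section one_sided_estimate.
Context {R : realType} {n : nat}.
Context (p c : R) (w v : Rn R n -> R).
Hypotheses (p1 : (1 <= p)%R) (ww : weight w) (wv : weight v).
Hypothesis test : one_sided_testing p w v c.
Implicit Types (E : set (Rn R n)) (t : R) (s : seq (cube_index n)).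

Let B : R := (2 `^ p * (overlap_bound n)%:R * c `^ p)%R.

Let B0 : (0 <= B)%R.
Proof. by rewrite !mulr_ge0// powR_ge0. Qed.

Let w_ge0 D : 0 <= wmeas w D.
Proof. by apply: integral_ge0 => x _; rewrite lee_fin; exact: ww.1. Qed.

Let v_ge0 D : 0 <= wmeas v D.
Proof. by apply: integral_ge0 => x _; rewrite lee_fin; exact: wv.1. Qed.

(** The testing condition is applied to the sparse parts, at half the density;
    this produces the factor [2 `^ p]. *)
Lemma one_density_level_bound t E s : (0 < t)%R -> measurable E ->
  {in s, forall d, (t * volume d)%:E < lebesgue (E `&` cube_plus d)} ->
  {in s, forall d, lebesgue (E `&` cube_plus d) <= (2 * t * volume d)%:E} ->
  (t `^ p)%:E * wmeas w (\big[setU/set0]_(d <- s) cube d) <= B%:E * wmeas v E.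
Proof.
move=> t0 mE lo hi.
have [g [gs dg cg]] := laminar_disjoint_cover s (@cube_laminar R n).
have mU s' : measurable (\big[setU/set0]_(d <- s') @cube R n d).
  by apply: bigsetU_measurable => d _; exact: measurable_cube.
have mS := measurable_sparse_part (R := R) g.
have wU : wmeas w (\big[setU/set0]_(d <- s) cube d) <=
    \sum_(d <- g) wmeas w (cube d).
  apply: le_trans (int_bigsetU_le lebesgue ww.1 ww.2 g measurable_cube).
  apply: (le_int_subset _ ww.1 ww.2) => //.
  rewrite -!bigcup_seq => x [d /= /cg[d' d'g dd'] dx].
  by exists d' => //; exact: dd'.
have vS : \sum_(d <- g) wmeas v (E `&` sparse_part g d) <=
    (overlap_bound n)%:R%:E * wmeas v E.
  apply: (sum_int_setI_le _ wv.1 wv.2) => // x _.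
  exact: sparse_part_overlap.
have tp : (t `^ p)%:E = (2 `^ p)%:E * ((t / 2) `^ p)%:E :> \bar R.
  by rewrite -EFinM -powRM ?ler0n ?divr_ge0 ?(ltW t0)// mulrC divfK.
rewrite tp /B -mulrA EFinM -!muleA.
apply: lee_wpmul2l; first by rewrite lee_fin powR_ge0.
apply: (@le_trans _ _
    (\sum_(d <- g) (c `^ p)%:E * wmeas v (E `&` sparse_part g d))).
  apply: (@le_trans _ _ (((t / 2) `^ p)%:E * \sum_(d <- g) wmeas w (cube d))).
    by apply: lee_wpmul2l => //; rewrite lee_fin powR_ge0.
  rewrite ge0_sume_distrr; last by [].
  rewrite big_seq [leRHS]big_seq; apply: lee_sum => d d_g.
  apply: test.
  - by apply: measurableI => //; exact: mS.
  - by move=> x [_ []].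
  - by rewrite divr_gt0.
  - apply: sparse_part_large => // d' d'g; [exact/lo/gs|exact/hi/gs].
rewrite -ge0_sume_distrr; last by [].
rewrite mulrC EFinM -muleA; apply: lee_wpmul2l => //.
by rewrite lee_fin powR_ge0.
Qed.

Let scale_up t (x : \bar R) : (0 < t)%R -> 0 <= x ->
  2%:E * ((t `^ p)%:E * x) <= ((2 * t) `^ p)%:E * x.
Proof.
move=> t0 x0; rewrite muleA; apply: lee_wpmul2r => //.
rewrite -EFinM lee_fin powRM ?ler0n ?(ltW t0)//.
apply: ler_wpM2r; first exact: powR_ge0.
by rewrite -[leLHS]powRr1// ler_powR// ler1n.
Qed.

(** Peeling off density levels. Densities never exceed 1, so the induction
    starts at the heights [t >= 1], where no cube qualifies. In the step, the
    cubes of density above [2 * t] contribute at most half of the total bound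
    because [2 * t `^ p <= (2 * t) `^ p]; this is where [1 <= p] enters. *)
Lemma finite_cover_bound t E s : (0 < t)%R -> measurable E ->
  {in s, forall d, (t * volume d)%:E < lebesgue (E `&` cube_plus d)} ->
  (t `^ p)%:E * wmeas w (\big[setU/set0]_(d <- s) cube d) <=
  (2 * B)%:E * wmeas v E.
Proof.
move=> t0 mE.
have [m] : exists m, (1 <= 2 ^+ m * t)%R.
  exists (Num.bound t^-1%R); rewrite -ler_pdivrMr// mul1r.
  exact/ltW/upper_nthrootP.
have mI d : measurable (E `&` cube_plus d).
  by apply: measurableI => //; exact: measurable_cube_plus.
have mU s' (P : pred _) :
    measurable (\big[setU/set0]_(d <- s' | P d) @cube R n d).
  by apply: bigsetU_measurable => d _; exact: measurable_cube.
elim: m t t0 s => [|m IH] t t0 s tm lo.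
  suff -> : s = [::].
    rewrite big_nil [wmeas w _]integral_set0 mule0.
    by apply: mule_ge0; [rewrite lee_fin mulr_ge0|exact: v_ge0].
  case: s lo => // d s /(_ d (mem_head _ _)); rewrite ltNge => /negP[].
  apply: (@le_trans _ _ (lebesgue (@cube_plus R n d))).
    apply: le_measure; rewrite ?inE//; exact: measurable_cube_plus.
  rewrite lebesgue_cube_plus lee_fin ler_peMl ?(ltW (volume_gt0 _))//.
  by move: tm; rewrite expr0 mul1r.
pose low d := lebesgue (E `&` cube_plus d) <= (2 * t * volume d)%:E.
rewrite (bigID low)/=.
set s1 := [seq d <- s | low d]; set s2 := [seq d <- s | ~~ low d].
rewrite -big_filter -[X in _ `|` X]big_filter -/s1 -/s2.
apply: (@le_trans _ _ ((t `^ p)%:E *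
  (wmeas w (\big[setU/set0]_(d <- s1) cube d) +
   wmeas w (\big[setU/set0]_(d <- s2) cube d)))).
  apply: lee_wpmul2l; first by rewrite lee_fin powR_ge0.
  exact: (int_setU_le _ ww.1 ww.2).
rewrite ge0_muleDr// mulrDl mul1r EFinD ge0_muleDl ?lee_fin//.
apply: leeD.
  apply: one_density_level_bound => // d; rewrite mem_filter => /andP[]//.
  by move=> _; exact: lo.
have t2 : (0 < 2 * t)%R by rewrite mulr_gt0.
have := IH _ t2 s2; rewrite mulrA -exprSr => /(_ tm) H.
rewrite -(@lee_pmul2l _ 2%:E)//.
rewrite [leRHS]muleA -EFinM.
apply: (le_trans (scale_up t0 (w_ge0 _))); apply: H => d.
rewrite mem_filter => /andP[].
by rewrite /low -ltNge.
Qed.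

End one_sided_estimate.

(** * Level sets of the maximal function *)

Section level_sets.
Context {R : realType} {n : nat}.
Implicit Types (E : set (Rn R n)) (t : R) (d : cube_index n).

Definition dense_cube E t d : bool :=
  (t * volume d)%:E < lebesgue (E `&` cube_plus d).

Lemma dyadic_maximal_gt E t : measurable E ->
  [set x | t%:E < dyadic_maximal \1_E x] =
  \bigcup_(d in [set` dense_cube E t]) cube d.
Proof.
move=> mE.
have denseE d : dense_cube E t d =
    (t%:E < (lebesgue (@dyadic_cube R n d.1 d.2))^-1 *
       \int[lebesgue]_(y in dyadic_cube_plus d.1 d.2) `|\1_E y|%:E).
  have mP := @measurable_dyadic_cube_plus R n d.1 d.2.
  under eq_integral do rewrite ger0_norm//.
  rewrite (integral_indic lebesgue mP mE).
  rewrite lebesgue_dyadic_cube inver gt_eqF ?exprn_gt0 ?side_gt0//.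
  by rewrite lte_pdivlMl ?exprn_gt0 ?side_gt0// -EFinM mulrC.
apply/seteqP; split => x /=.
  move=> /ereal_sup_gt[_ [[j k] /= Qx <-] tx].
  have kE : finfun k = k :> ('I_n -> int) by apply/funext => i; rewrite ffunE.
  exists (j, finfun k); rewrite /cube /= ?kE//.
  by rewrite -[_ \in _]/(dense_cube E t _) denseE /= kE.
move=> [d td dx]; have : dense_cube E t d by [].
rewrite denseE => {}td; apply: lt_le_trans td _.
by apply: ereal_sup_ubound; exists (d.1, d.2 : 'I_n -> int).
Qed.

Lemma measurable_dyadic_maximal_gt E t : measurable E ->
  measurable [set x | t%:E < dyadic_maximal \1_E x].
Proof.
move=> mE; rewrite dyadic_maximal_gt// bigcup_mkcond.
apply: countable_bigcupT_measurable; first exact: countableP.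
move=> d; case: ifP => _; [exact: measurable_cube|exact: measurable0].
Qed.

Lemma dense_cube_subset E t d : measurable E -> dense_cube E t d ->
  cube d `<=` [set x | t%:E < dyadic_maximal \1_E x].
Proof. by move=> mE td x dx; rewrite dyadic_maximal_gt//; exists d. Qed.

Lemma testing_restricted_weak_type (p c : R) (w v : Rn R n -> R) :
  (1 <= p)%R -> weight w -> weight v -> one_sided_testing p w v c ->
  restricted_weak_type p w v
    (2 * (2 `^ p * (overlap_bound n)%:R * c `^ p))%:E.
Proof.
move=> p1 ww wv test t E t0 mE.
have tp : (0 < t `^ p)%R by rewrite powR_gt0.
rewrite inver gt_eqF// (muleC _ (_^-1)%:E) -muleA lee_pdivlMl//.
pose s m := [seq d <- pmap unpickle (iota 0 m) | dense_cube E t d].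
pose F m : set (Rn R n) := \big[setU/set0]_(d <- s m) cube d.
have FU : \bigcup_m F m = [set x | t%:E < dyadic_maximal \1_E x].
  rewrite dyadic_maximal_gt//; apply/seteqP; split => x.
    move=> [m _]; rewrite /F -bigcup_seq => -[d /=].
    by rewrite mem_filter => /andP[td _] dx; exists d.
  move=> [d /= td dx]; exists (pickle d).+1 => //.
  rewrite /F -bigcup_seq; exists d => //=.
  rewrite mem_filter (td : dense_cube E t d) mem_pmap.
  by apply/mapP; exists (pickle d); rewrite ?pickleK// mem_iota ltnSn.
have mF m : measurable (F m).
  by apply: bigsetU_measurable => d _; exact: measurable_cube.
have ndF : {homo F : m m' / (m <= m')%N >-> (m <= m')%O}.
  move=> m m' mm'; apply/subsetPset; rewrite /F -!bigcup_seq => x [d /=].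
  rewrite mem_filter mem_pmap => /andP[td /mapP[i im di]] dx; exists d => //=.
  rewrite mem_filter td mem_pmap; apply/mapP; exists i => //.
  by move: im; rewrite !mem_iota/= !add0n => /leq_trans; apply.
have Fw m : wmeas w (F m) <= ((t `^ p)^-1)%:E *
    ((2 * (2 `^ p * (overlap_bound n)%:R * c `^ p))%:E * wmeas v E).
  rewrite lee_pdivlMl//; apply: (finite_cover_bound p1 ww wv test t0 mE) => d.
  by rewrite mem_filter => /andP[].
rewrite -lee_pdivlMl// -FU.
exact: int_bigcup_le ww.1 ww.2 _ _ ndF mF Fw.
Qed.

End level_sets.

(** * From the weighted class to testing constants, and back *)

Section testing_constants.
Context {R : realType} {n : nat}.
Context (p : R) (w v : Rn R n -> R).
Hypotheses (p1 : (1 <= p)%R) (ww : weight w) (wv : weight v).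
Implicit Types (A D E : set (Rn R n)) (d : cube_index n).

Let p0 : (0 < p)%R.
Proof. exact: lt_le_trans p1. Qed.

Let pn0 : (p != 0)%R.
Proof. exact: lt0r_neq0. Qed.

Let w_ge0 D : 0 <= wmeas w D.
Proof. by apply: integral_ge0 => x _; rewrite lee_fin; exact: ww.1. Qed.

Let v_ge0 D : 0 <= wmeas v D.
Proof. by apply: integral_ge0 => x _; rewrite lee_fin; exact: wv.1. Qed.

Lemma lebesgue_sub_cube_plus_le A d : measurable A -> A `<=` cube_plus d ->
  lebesgue A <= (volume d)%:E.
Proof.
move=> mA Ad; rewrite -lebesgue_cube_plus; apply: le_measure; rewrite ?inE//.
exact: measurable_cube_plus.
Qed.

(** Truncating [v] at a large height. It serves to exclude or neutralize
    infinite masses: without it, nothing can be deduced from [v(A) = +oo]. *)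
Lemma finite_weight_part A d : measurable A -> A `<=` cube_plus d ->
  0 < lebesgue A -> exists A', [/\ measurable A', A' `<=` A,
    0 < lebesgue A' & wmeas v A' < +oo].
Proof.
move=> mA Ad A0.
pose F m := A `&` (v @^-1` `]-oo, m%:R]).
have mF m : measurable (F m).
  rewrite /F -[X in _ `&` X]setTI; apply: measurableI => //.
  by apply: wv.2 => //; exact: measurable_itv.
have ndF : {homo F : m m' / (m <= m')%N >-> (m <= m')%O}.
  move=> m m' mm'; apply/subsetPset => x [Ax]; rewrite /= !in_itv/= => vm.
  by split => //=; rewrite in_itv/= (le_trans vm)// ler_nat.
have FU : \bigcup_m F m = A.
  apply/seteqP; split => x; first by case=> m _ [].
  move=> Ax; exists (Num.bound (v x)) => //; split => //=.
  by rewrite in_itv/= ltW// archi_boundP// wv.1.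
have [[m Fm]|N] := pselect (exists m, 0 < lebesgue (F m)).
  exists (F m); split => //; first by move=> x [].
  apply: (@le_lt_trans _ _ (m%:R%:E * lebesgue (F m))).
    rewrite -integral_cst//; apply: ge0_le_integral => //.
    - by move=> x _; rewrite lee_fin wv.1.
    - by apply/measurable_EFinP; apply: measurable_funTS; exact: wv.2.
    - by move=> x [_]; rewrite /= in_itv/= lee_fin.
  apply: (@le_lt_trans _ _ (m%:R%:E * (volume d)%:E)).
    apply: lee_wpmul2l => //; apply: lebesgue_sub_cube_plus_le => // x [Ax _].
    exact: Ad.
  by rewrite -EFinM ltry.
have F0 m : lebesgue (F m) = 0.
  apply/eqP; rewrite eq_le measure_ge0 andbT leNgt; apply/negP => Fm.
  by apply: N; exists m.
have mUF : measurable (\bigcup_m F m) by rewrite FU.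
have := nondecreasing_cvg_mu mF mUF ndF (mu := lebesgue).
rewrite FU (_ : _ \o F = cst 0); last by apply/funext.
move=> /cvg_lim; rewrite lim_cst// => A00.
by move: A0; rewrite -[lebesgue A]A00// ltxx.
Qed.

(** When [w(Q)] is infinite the quotient is 0 and the A_p inequality would force
    [|A| = 0], against [s > 0]; so only finite values remain. *)
Lemma Ap_bound_testing (C : R) : (0 < C)%R -> Ap_bound p w v C ->
  one_sided_testing p w v C.
Proof.
move=> C0 ap d A s mA Ad s0 sA.
have {ap} := ap d.1 d.2 A mA Ad.
rewrite [lebesgue (dyadic_cube _ _)]lebesgue_cube inver gt_eqF ?volume_gt0//.
rewrite -/(cube d) => ap.
have {sA} : s%:E <= lebesgue A * ((volume d)^-1)%:E.
  by rewrite lee_pdivlMr ?volume_gt0// -EFinM.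
move=> /le_trans/(_ ap); rewrite /quotient.
have [->|w0] := eqVneq (wmeas w (cube d)) 0.
  by move=> _; rewrite mule0 mule_ge0// lee_fin powR_ge0.
have Cp : (0 < C `^ p)%R by rewrite powR_gt0.
have := w_ge0 (cube d); have := v_ge0 A.
case: (wmeas w (cube d)) w0 => [W| |]//; last first.
  move=> _ _ _; rewrite invey mule0 poweR_EFin powR0 ?invr_eq0 ?gt_eqF//.
  by rewrite -EFinM mulr0 lee_fin leNgt s0.
rewrite eqe => W0; case: (wmeas v A) => [V| |]//; last first.
  by move=> _ _ _; rewrite gt0_muley ?lte_fin// leey.
rewrite !lee_fin inver (negbTE W0) => V0 Wge.
have Wgt : (0 < W)%R by rewrite lt_neqAle eq_sym W0.
rewrite -(EFinM V) poweR_EFin -EFinM lee_fin => h.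
have q0 : (0 <= V / W)%R by rewrite divr_ge0.
have : (s `^ p <= (C * (V / W) `^ p^-1) `^ p)%R.
  apply: ge0_ler_powR h; rewrite ?nnegrE ?(ltW p0) ?(ltW s0)//.
  by rewrite mulr_ge0 ?powR_ge0// ltW.
rewrite powRM ?powR_ge0 ?(ltW C0)// -powRrM mulVf ?gt_eqF// powRr1//.
by rewrite mulrA ler_pdivlMr.
Qed.

Lemma Ap_const_fin_num : Ap p w v ->
  exists2 c : R, (0 <= c)%R & Ap_const p w v = c%:E.
Proof.
move=> [C C0 apC].
have c0 : 0 <= Ap_const p w v.
  by apply/ereal_infP => _ [C' [C'0 _] <-]; rewrite lee_fin ltW.
have cC : Ap_const p w v <= C%:E by apply: ereal_inf_lbound; exists C.
move: c0 cC; case: (Ap_const p w v) => [c| |]//.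
by rewrite lee_fin => c0 _; exists c.
Qed.

(** When [v(A)] is finite, the testing condition for [C] solves to a lower bound
    on [C] that is the same for all admissible [C], hence it passes to the
    infimum. *)
Lemma Ap_const_testing_fin (c : R) d A (s : R) :
  (0 <= c)%R -> Ap_const p w v = c%:E -> Ap p w v ->
  measurable A -> A `<=` cube_plus d -> (0 < s)%R ->
  (s * volume d)%:E <= lebesgue A -> wmeas v A < +oo ->
  (s `^ p)%:E * wmeas w (cube d) <= (c `^ p)%:E * wmeas v A.
Proof.
move=> c0 cE [C0 C00 apC0] mA Ad s0 sA.
have bnd C : (0 < C)%R -> Ap_bound p w v C ->
    (s `^ p)%:E * wmeas w (cube d) <= (C `^ p)%:E * wmeas v A.
  by move=> C_gt0 apC; exact: (Ap_bound_testing C_gt0 apC).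
have sp : (0 < s `^ p)%R by rewrite powR_gt0.
have := v_ge0 A; case: (wmeas v A) bnd => [V| |]// bnd; rewrite lee_fin => V0 _.
have := w_ge0 (cube d).
case: (wmeas w (cube d)) bnd => [W| |]// bnd; last first.
  by have := bnd _ C00 apC0; rewrite gt0_muley ?lte_fin.
rewrite lee_fin => W0; rewrite -!EFinM lee_fin.
move: V0; rewrite le_eqVlt => /predU1P[V0|V0].
  by have := bnd _ C00 apC0; rewrite -V0 -!EFinM lee_fin !mulr0.
have q0 : (0 <= s `^ p * W / V)%R.
  by rewrite divr_ge0 ?(ltW V0)// mulr_ge0// ltW.
rewrite -ler_pdivrMr// -[leLHS]powRr1// -(mulVf pn0) powRrM.
apply: ge0_ler_powR; rewrite ?nnegrE ?powR_ge0 ?(ltW p0)//.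
rewrite -lee_fin -cE; apply/ereal_infP => _ [C [C_gt0 apC] <-].
rewrite lee_fin; have := bnd _ C_gt0 apC.
rewrite -!EFinM lee_fin -ler_pdivrMr// => h.
rewrite -[leRHS]powRr1 ?(ltW C_gt0)// -[X in (_ <= _ `^ X)%R](mulfV pn0) powRrM.
by apply: ge0_ler_powR h; rewrite ?nnegrE ?powR_ge0 ?invr_ge0 ?(ltW p0).
Qed.

(** Infinite [v(A)] matters only if [c = 0], the right-hand side being then
    [0 * +oo = 0]. Testing on a part of [A] of finite mass shows that
    [w(Q) = 0]. *)
Lemma Ap_const_testing (c : R) : (0 <= c)%R -> Ap_const p w v = c%:E ->
  Ap p w v -> one_sided_testing p w v c.
Proof.
move=> c0 cE ap d A s mA Ad s0 sA.
have [vfin|] := ltP (wmeas v A) +oo; first exact: Ap_const_testing_fin.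
rewrite leye_eq => /eqP vE; rewrite vE.
move: c0 cE; rewrite le_eqVlt => /predU1P[<-|c0] cE; last first.
  by rewrite gt0_muley ?leey// lte_fin powR_gt0.
have A0 : 0 < lebesgue A.
  by apply: lt_le_trans sA; rewrite lte_fin mulr_gt0// volume_gt0.
have [A' [mA' A'A A'0 vA']] := finite_weight_part mA Ad A0.
have A'd := subset_trans A'A Ad.
have := lebesgue_sub_cube_plus_le mA' A'd.
move: A'0; case LA' : (lebesgue A') => [a| |]//; rewrite lte_fin => a0 _.
have V0 := volume_gt0 (R := R) d.
have s'0 : (0 < a / volume d)%R by rewrite divr_gt0.
have := Ap_const_testing_fin (lexx _) cE ap mA' A'd s'0.
rewrite LA' divfK ?gt_eqF// => /(_ (lexx _) vA').
rewrite powR0 ?gt_eqF// !mul0e pmule_rle0 ?lte_fin ?powR_gt0// => w0.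
have -> : wmeas w (cube d) = 0 by apply/eqP; rewrite eq_le w0 w_ge0.
by rewrite mule0.
Qed.

Lemma restricted_weak_type_cube (K : R) d A (t : R) :
  restricted_weak_type p w v K%:E -> measurable A -> A `<=` cube_plus d ->
  (0 < t)%R -> (t * volume d)%:E < lebesgue A ->
  (t `^ p)%:E * wmeas w (cube d) <= K%:E * wmeas v A.
Proof.
move=> rw mA Ad t0 tA.
have tp : (0 < t `^ p)%R by rewrite powR_gt0.
have := rw t A t0 mA.
rewrite inver gt_eqF// (muleC _ (_^-1)%:E) -muleA lee_pdivlMl//.
apply: le_trans; apply: lee_wpmul2l; first by rewrite lee_fin ltW.
apply: (le_int_subset _ ww.1 ww.2).
- exact: measurable_cube.
- exact: measurable_dyadic_maximal_gt.
- by apply: dense_cube_subset => //; rewrite /dense_cube (setIidl Ad).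
Qed.

(** Were [w(Q)] infinite, testing on a subset of [Q+] of positive measure and
    finite mass would give an infinite lower bound for a finite quantity. *)
Lemma restricted_weak_type_finite (K : R) d :
  restricted_weak_type p w v K%:E -> wmeas w (cube d) < +oo.
Proof.
move=> rw; have mP := @measurable_cube_plus R n d.
have V0 := volume_gt0 (R := R) d.
have P0 : 0 < lebesgue (@cube_plus R n d) by rewrite lebesgue_cube_plus lte_fin.
have [A [mA Ad A0 vA]] := finite_weight_part mP (@subset_refl _ _) P0.
have := lebesgue_sub_cube_plus_le mA Ad.
move: A0; case LA : (lebesgue A) => [a| |]//; rewrite lte_fin => a0 _.
pose t := (a / volume d / 2)%R.
have t0 : (0 < t)%R by rewrite !divr_gt0.
have tp : (0 < t `^ p)%R by rewrite powR_gt0.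
have := @restricted_weak_type_cube K d A t rw mA Ad t0.
rewrite LA lte_fin /t mulrAC divfK ?gt_eqF// => H.
rewrite ltey; apply/eqP => wy; move: H; rewrite wy gt0_muley ?lte_fin//.
have := v_ge0 A; case: (wmeas v A) vA => [V| |]// _ _.
move=> H; have : (a / 2 < a)%R by lra.
by move=> /H.
Qed.

Lemma restricted_weak_type_Ap (K : R) : (0 < K)%R ->
  restricted_weak_type p w v K%:E -> Ap p w v.
Proof.
move=> K0 rw; exists (K `^ p^-1)%R; first by rewrite powR_gt0.
move=> j k A mA.
pose d : cube_index n := (j, finfun k).
have kE : finfun k = k :> ('I_n -> int) by apply/funext => i; rewrite ffunE.
have -> : dyadic_cube j k = @cube R n d by rewrite /cube /= kE.
have -> : dyadic_cube_plus j k = @cube_plus R n d by rewrite /cube_plus /= kE.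
move=> Ad.
have V0 := volume_gt0 (R := R) d.
have Kp : (0 < K `^ p^-1)%R by rewrite powR_gt0.
have := lebesgue_sub_cube_plus_le mA Ad.
have : 0 <= lebesgue A by [].
case LA : (lebesgue A) => [a| |]//; rewrite lee_fin => a0 _.
rewrite lebesgue_cube inver gt_eqF// -EFinM /quotient.
have [w0|w0] := eqVneq (wmeas w (cube d)) 0.
  by rewrite poweRyr ?invr_eq0 ?gt_eqF// gt0_muley ?lte_fin// leey.
have H t : (0 < t)%R -> (t < a / volume d)%R ->
    (t `^ p)%:E * wmeas w (cube d) <= K%:E * wmeas v A.
  move=> t0; rewrite ltr_pdivlMr// => ta.
  by apply: restricted_weak_type_cube => //; rewrite LA lte_fin.
have := restricted_weak_type_finite d rw; have := w_ge0 (cube d).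
case: (wmeas w (cube d)) w0 H => [W| |]//.
rewrite eqe lee_fin => W0 H Wge _.
have Wgt : (0 < W)%R by rewrite lt_neqAle eq_sym W0.
have := v_ge0 A; case: (wmeas v A) H => [V| |]// H; last first.
  move=> _; rewrite inver (negbTE W0) gt0_mulye ?lte_fin ?invr_gt0//.
  by rewrite poweRyr ?invr_eq0 ?gt_eqF// gt0_muley ?lte_fin// leey.
rewrite lee_fin => V_ge0; rewrite inver (negbTE W0).
rewrite -(EFinM V) poweR_EFin -EFinM lee_fin.
have q0 : (0 <= V / W)%R by rewrite divr_ge0.
rewrite -powRM ?(ltW K0)//.
set x := powR _ _.
have x0 : (0 <= x)%R by exact: powR_ge0.
rewrite leNgt; apply/negP => xa.
(* The testing inequality holds strictly below a / volume d only; if that value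
   exceeded x, the midpoint would contradict it. *)
pose t := ((x + a / volume d) / 2)%R.
have t0 : (0 < t)%R by rewrite /t; lra.
have ta : (t < a / volume d)%R by rewrite /t; lra.
have := H t t0 ta; rewrite -!EFinM lee_fin -ler_pdivlMr// -mulrA => h.
have : (t <= x)%R.
  rewrite -[leLHS]powRr1 ?(ltW t0)// -(mulfV pn0) powRrM.
  apply: ge0_ler_powR h; rewrite ?nnegrE ?powR_ge0 ?invr_ge0 ?(ltW p0)//.
  by rewrite mulr_ge0// ltW.
by rewrite /t; lra.
Qed.

End testing_constants.

Theorem theorem1 (R : realType) (n : nat) (p : R) (hn : (0 < n)%N)
    (hp : (1 <= p)%R) :
  exists2 C : R, (0 < C)%R &
    forall w v : Rn R n -> R, weight w -> weight v ->
      ((exists2 K : R, (0 < K)%R & restricted_weak_type p w v K%:E) <->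
         Ap p w v) /\
      (Ap p w v ->
         restricted_weak_type p w v (C%:E * Ap_const p w v `^ p)).
Proof.
pose C : R := (2 * (2 `^ p * (overlap_bound n)%:R))%R.
have C0 : (0 < C)%R.
  by rewrite !mulr_gt0 ?powR_gt0// ltr0n muln_gt0 expn_gt0.
exists C => // w v ww wv; split.
  split=> [[K K0]|[A A0 apA]]; first exact: restricted_weak_type_Ap.
  exists (C * A `^ p)%R; first by rewrite mulr_gt0// powR_gt0.
  rewrite /C -mulrA; apply: testing_restricted_weak_type => //.
  exact: Ap_bound_testing.
move=> ap; have [c c0 cE] := Ap_const_fin_num ap.
rewrite cE poweR_EFin -EFinM /C -mulrA.
apply: testing_restricted_weak_type => //.
exact: Ap_const_testing.
Qed.
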